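(* There exists an instance of the linear bandit problem with partially observable features (described in the context), i.e. a number of arms $K$, dimensions $d,d_u\ge 1$, feature vectors $\mathbf z_1,\dots,\mathbf z_K\in\mathbb R^{d+d_u}$, a parameter $\boldsymbol\theta_\star\in\mathbb R^{d+d_u}$ with $|\langle \mathbf z_a,\boldsymbol\theta_\star\rangle|\le 1$ for all $a\in[K]$, and a conditionally $\sigma$-sub-Gaussian noise sequence, on which both OFUL and LinTS, each run using only the observed features $\mathbf x_1,\dots,\mathbf x_K$, suffer cumulative expected regret growing linearly in $T$: there are constants $c>0$ and $T_0\in\mathbb N$ such that, for all $T\ge T_0$, $$\mathbb E[\mathrm{Regret}_{\mathrm{OFUL}}(T)]\ge cT\qquad\text{and}\qquad \mathbb E[\mathrm{Regret}_{\mathrm{LinTS}}(T)]\ge cT .$$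
   Context: Problem. There are $K$ arms; arm $a\in[K]=\{1,\dots,K\}$ has a fixed true feature vector $\mathbf z_a=[\mathbf x_a^\top,\mathbf u_a^\top]^\top\in\mathbb R^{d+d_u}$, where $\mathbf x_a\in\mathbb R^d$ is observed by the agent and $\mathbf u_a\in\mathbb R^{d_u}$ is not. An unknown parameter is $\boldsymbol\theta_\star=[(\boldsymbol\theta_\star^{(o)})^\top,(\boldsymbol\theta_\star^{(u)})^\top]^\top$ with $\boldsymbol\theta_\star^{(o)}\in\mathbb R^d$, $\boldsymbol\theta_\star^{(u)}\in\mathbb R^{d_u}$. At each round $t=1,2,\dots$ the agent chooses $a_t\in[K]$ and observes $y_{a_t,t}=\langle\mathbf z_{a_t},\boldsymbol\theta_\star\rangle+\epsilon_t$, where $\epsilon_t$ is conditionally $\sigma$-sub-Gaussian: $\mathbb E[\exp(\lambda\epsilon_t)\mid\text{history up to and including }a_t]\le\exp(\lambda^2\sigma^2/2)$ for all $\lambda\in\mathbb R$. With $a_\star\in\arg\max_a\langle\mathbf z_a,\boldsymbol\theta_\star\rangle$, the regret is $\mathrm{Regret}(T)=\sum_{t=1}^T\langle\boldsymbol\theta_\star,\mathbf z_{a_\star}-\mathbf z_{a_t}\rangle$. Algorithms (both use only the observed features, as if the reward were linear in $\mathbf x_a$). For regularization $\lambda>0$ let $\mathbf V_t=\lambda\mathbf I_d+\sum_{\tau=1}^t\mathbf x_{a_\tau}\mathbf x_{a_\tau}^\top$ and $\widehat{\boldsymbol\theta}_t=\mathbf V_t^{-1}\sum_{\tau=1}^t\mathbf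 x_{a_\tau}y_{a_\tau,\tau}$. OFUL (fixed inputs $\lambda>0$, $\delta\in(0,1)$, $S\ge\|\boldsymbol\theta_\star^{(o)}\|_2$): $a_{t+1}\in\arg\max_a\{\mathbf x_a^\top\widehat{\boldsymbol\theta}_t+\beta_t\sqrt{\mathbf x_a^\top\mathbf V_t^{-1}\mathbf x_a}\}$, with $\beta_t=\sigma\sqrt{2\log(\det(\mathbf V_t)^{1/2}\det(\lambda\mathbf I_d)^{-1/2}/\delta)}+\sqrt\lambda\,S$. LinTS (fixed input $v>0$, with $\lambda=1$): conditionally on the past draw $\tilde{\boldsymbol\theta}_t\sim\mathcal N(\widehat{\boldsymbol\theta}_t,v^2\mathbf V_t^{-1})$ and play $a_{t+1}\in\arg\max_a\mathbf x_a^\top\tilde{\boldsymbol\theta}_t$. *)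

(* Defs.v *)
From HB Require Import structures.
From mathcomp Require Import all_boot all_order all_algebra.
From mathcomp Require Import all_classical all_reals all_analysis.

Set Implicit Arguments.
Unset Strict Implicit.
Unset Printing Implicit Defensive.

Import Order.TTheory GRing.Theory Num.Theory.
Import numFieldNormedType.Exports.

Local Open Scope classical_set_scope.
Local Open Scope ring_scope.

(* The norm that the library puts on 'cV[R]_n is the sup norm, hence the
   Euclidean structure below. *)
Definition dot (R : realType) (n : nat) (u w : 'cV[R]_n) : R :=
  (u^T *m w) ord0 ord0.

Definition l2norm (R : realType) (n : nat) (u : 'cV[R]_n) : R :=
  Num.sqrt (dot u u).

Definition qform (R : realType) (n : nat) (A : 'M[R]_n) (u : 'cV[R]_n) : R :=
  dot u (A *m u).

Definition is_argmax (R : realType) (I : Type) (f : I -> R) (i : I) : Prop :=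
  forall j : I, f j <= f i.

(* Rounds are numbered from 0: for sequences of arms and rewards, index [s]
   is round [s + 1] of the usual numbering, so that the first [t] rounds are
   the indices [s < t], the statistics V_t and hat theta_t are [gram _ _ _ t]
   and [ridge _ _ _ _ t], and they determine the arm [a t] (i.e. a_{t+1}). *)

Section Statistics.
Variables (R : realType) (K d : nat) (lambda : R) (x : 'I_K -> 'cV[R]_d).

Definition gram (a : nat -> 'I_K) (t : nat) : 'M[R]_d :=
  lambda%:M + \sum_(s < t) x (a s) *m (x (a s))^T.

Definition ridge (a : nat -> 'I_K) (y : nat -> R) (t : nat) : 'cV[R]_d :=
  invmx (gram a t) *m \sum_(s < t) y s *: x (a s).

Definition oful_radius (sigma delta S : R) (a : nat -> 'I_K) (t : nat) : R :=
  sigma * Num.sqrt (2 * ln (Num.sqrt (\det (gram a t))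
                            * (Num.sqrt (\det (lambda%:M : 'M[R]_d)))^-1
                            / delta))
  + Num.sqrt lambda * S.

Definition oful_index (sigma delta S : R) (a : nat -> 'I_K) (y : nat -> R)
    (t : nat) (k : 'I_K) : R :=
  dot (x k) (ridge a y t)
  + oful_radius sigma delta S a t * Num.sqrt (qform (invmx (gram a t)) (x k)).

End Statistics.

Section Conditioning.
Context (d : measure_display) (Om : measurableType d) (R : realType).
Variable P : probability Om R.

(* [Y] is a version of the conditional expectation E[X | F], for a
   sub-sigma-algebra [F] given by its set of events. *)
Definition is_cond_exp (F : set (set Om)) (X Y : Om -> R) : Prop :=
  [/\ P.-integrable setT (EFin \o X),
      P.-integrable setT (EFin \o Y),
      forall B : set R, measurable B -> F (Y @^-1` B) &
      forall A : set Om, F A ->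
        (\int[P]_(w in A) (X w)%:E = \int[P]_(w in A) (Y w)%:E)%E].

Definition cond_subgaussian (sigma : R) (F : set (set Om)) (e : Om -> R) :
    Prop :=
  forall l : R, exists2 Y : Om -> R,
    is_cond_exp F (fun w => expR (l * e w)) Y &
    {ae P, forall w, Y w <= expR (l ^+ 2 * sigma ^+ 2 / 2)}.

(* Conditionally on [F], [th] has the multivariate normal distribution with
   mean [m] and (invertible) covariance matrix [C]: every nonzero linear
   functional <u, th> has conditional law N(<u, m>, u^T C u), that is,
   P(<u, th> \in B | F) = N(<u, m>, u^T C u)(B) for every Borel set [B].
   The second parameter of [normal_prob] is the standard deviation, and
   [normal_prob _ 0] is not a Dirac mass, which is why [u = 0] is left out. *)
Definition cond_gaussian (n : nat) (F : set (set Om)) (m : Om -> 'cV[R]_n)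
    (C : Om -> 'M[R]_n) (th : Om -> 'cV[R]_n) : Prop :=
  forall u : 'cV[R]_n, u != 0 -> forall B : set R, measurable B ->
    is_cond_exp F
      (\1_((fun w => dot u (th w)) @^-1` B))
      (fun w => fine (normal_prob (dot u (m w)) (Num.sqrt (qform (C w) u)) B)).

End Conditioning.

Section Histories.
Context (d : measure_display) (Om : measurableType d) (R : realType).
Variables (K n : nat).

Definition arm_events (a : nat -> Om -> 'I_K) (t : nat) : set (set Om) :=
  \bigcup_(s in `I_t) preimage_set_system setT (a s) setT.

Definition reward_events (y : nat -> Om -> R) (t : nat) : set (set Om) :=
  \bigcup_(s in `I_t) preimage_set_system setT (y s) measurable.

Definition draw_events (th : nat -> Om -> 'cV[R]_n) (t : nat) : set (set Om) :=
  \bigcup_(s in `I_t) \bigcup_(i in [set: 'I_n])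
    preimage_set_system setT (fun w => th s w i ord0) measurable.

End Histories.

Section Interaction.
Context (disp : measure_display) (Om : measurableType disp) (R : realType).
Variables (P : probability Om R) (eps : nat -> {RV P >-> R}) (sigma : R).
Variables (K d du : nat) (z : 'I_K -> 'cV[R]_(d + du)).
Variable theta : 'cV[R]_(d + du).

Definition observed (k : 'I_K) : 'cV[R]_d := usubmx (z k).

Definition reward (a : nat -> Om -> 'I_K) (t : nat) (w : Om) : R :=
  dot (z (a t w)) theta + eps t w.

Definition regret (astar : 'I_K) (a : nat -> Om -> 'I_K) (T : nat) (w : Om) :
    R :=
  \sum_(t < T) dot theta (z astar - z (a t w)).

Definition oful_run (lambda delta S : R) (a : nat -> Om -> 'I_K) : Prop :=
  forall t : nat,
  [/\ forall k : 'I_K, measurable (a t @^-1` [set k]),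
      forall w : Om,
        is_argmax
          (oful_index lambda observed sigma delta S
             (fun s => a s w) (fun s => reward a s w) t)
          (a t w) &
      cond_subgaussian P sigma
        <<s arm_events a t.+1 `|` reward_events (reward a) t >>
        (eps t)].

(* [th t] is the draw that selects the arm [a t]. The agent's past draws belong
   to the past on which a new draw and a new noise term are conditioned. *)
Definition lints_run (v : R) (a : nat -> Om -> 'I_K)
    (th : nat -> Om -> 'cV[R]_d) : Prop :=
  forall t : nat,
  [/\ forall k : 'I_K, measurable (a t @^-1` [set k]),
      forall i : 'I_d, measurable_fun setT (fun w => th t w i ord0),
      cond_gaussian P
        <<s arm_events a t `|` reward_events (reward a) t
            `|` draw_events th t >>
        (fun w => ridge 1 observed
                    (fun s => a s w) (fun s => reward a s w) t)
        (fun w => v ^+ 2 *: invmx (gram 1 observed (fun s => a s w) t))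
        (th t),
      forall w : Om, is_argmax (fun k => dot (observed k) (th t w)) (a t w) &
      cond_subgaussian P sigma
        <<s arm_events a t.+1 `|` reward_events (reward a) t
            `|` draw_events th t.+1 >>
        (eps t)].

End Interaction.

(* Main.v *)
(* Arms 0, 1, 2 have observed features 0, 1, -1 and rewards 1, 0, 0, the
   reward of arm 0 being carried by its hidden coordinate; there is no noise.
   A linear model in the observed feature predicts 0 for arm 0 and opposite
   values for the other two: OFUL, whose exploration bonus vanishes exactly at
   the feature 0, and LinTS, whose sample is almost surely nonzero, both prefer
   one of the two bad arms at every round, so the regret is T.

   That runs exist is trivial for OFUL (arm 1 forever). LinTS requires i.i.d.
   standard normal variables, obtained on [0, 1] with the uniform law: the
   numbers U and V made of the even and the odd binary digits of a uniform
   number are independent and uniform, so the functions U o V^n are i.i.d.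
   uniform, and a quantile transform makes them normal. The joint tail
   function F(a, b) = P(U > a, V > b) satisfies
   F(a, b) = (F(b, 2a - 1) + F(b, 2a)) / 2, as does the product of the
   marginal tails, and this equation has only one bounded solution with the
   right boundary values. *)

Require Import Defs.
From HB Require Import structures.
From mathcomp Require Import all_boot all_order all_algebra.
From mathcomp Require Import all_classical all_reals all_analysis.
From mathcomp Require Import measurable_realfun ring lra.

Set Implicit Arguments.
Unset Strict Implicit.
Unset Printing Implicit Defensive.

Import Order.TTheory GRing.Theory Num.Theory.
Import numFieldNormedType.Exports.

Local Open Scope classical_set_scope.
Local Open Scope ring_scope.

(** * Borel measures on the line: uniqueness and scaling *)

(** The open right rays form a pi-system generating the Borel sets, and the rays starting at
    [- n%:R] exhaust the line. *)
Lemma measure_unique_ray (R : realType)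
    (m1 m2 : {measure set (measurableTypeR R) -> \bar R}) :
  (m1 setT < +oo)%E ->
  (forall x : R, m1 `]x, +oo[%classic = m2 `]x, +oo[%classic) ->
  forall A, measurable A -> m1 A = m2 A.
Proof.
move=> m1T m12.
apply: (@measure_unique _ _ (measurableTypeR R) (@RGenOInfty.G R)
         (fun n => `](- n%:R), +oo[%classic)).
- exact: RGenOInfty.measurableE.
- move=> _ _ [x ->] [y ->]; exists (Num.max x y).
  by apply/seteqP; split=> r /=; rewrite !in_itv/= !andbT gt_max; move=> /andP.
- by move=> i; eexists.
- rewrite -subTset => x _; exists (Num.trunc (- x)).+1 => //=.
  by rewrite in_itv/= andbT ltrNl truncnS_gt.
- by move=> _ [x ->]; exact: m12.
- by move=> k; apply: le_lt_trans m1T; apply: le_measure; rewrite ?inE.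
Qed.

(** [|k|] times the image of Lebesgue measure gives half-open intervals their length, which
    characterizes Lebesgue measure. *)
Lemma lebesgue_measure_affine (R : realType) (k c : R)
    (A : set (measurableTypeR R)) :
  k != 0 -> measurable A ->
  (lebesgue_measure
     ((fun x : measurableTypeR R => (k * x + c : measurableTypeR R)%R) @^-1` A) =
   `|k|^-1%:E * lebesgue_measure A)%E.
Proof.
move=> k0 mA.
pose f (x : measurableTypeR R) : measurableTypeR R := k * x + c.
have mf : measurable_fun setT f.
  by apply: measurable_funD => //; exact: measurable_funM.
pose m : {measure set (measurableTypeR R) -> \bar R} :=
  mscale (NngNum (normr_ge0 k)) (pushforward lebesgue_measure f).
suff -> : lebesgue_measure A = m mf A.
  rewrite /m/= /mscale/= /pushforward muleA -EFinM mulVf ?mul1e//.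
  by rewrite normr_eq0.
apply: lebesgue_measure_unique => // _ [[a b] _ <-]/=.
rewrite /m/= /mscale/= /pushforward /=.
have [k_gt0|k_lt0|k_eq0] := ltgtP 0 k; last by rewrite k_eq0 eqxx in k0.
- rewrite (_ : _ @^-1` _ = `]((a - c) / k), ((b - c) / k)]%classic); last first.
    apply/seteqP; split=> x /=; rewrite !in_itv/= /f ltr_pdivrMr//
      ler_pdivlMr// ltrBlDr lerBrDr mulrC//.
  rewrite !lebesgue_measure_itv/= !lte_fin ltr_pM2r ?invr_gt0// ltrD2r.
  case: ifP => _; last by rewrite mule0.
  rewrite gtr0_norm// -!EFinB -EFinM; congr EFin.
  by field; lra.
(* A negative slope swaps the endpoints, so the preimage is closed on the left and open on the
   right; its length is unaffected. *)
- rewrite (_ : _ @^-1` _ = `[((b - c) / k), ((a - c) / k)[%classic); last first.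
    apply/seteqP; split=> x /=; rewrite !in_itv/= /f ltr_ndivlMr//
      ler_ndivrMr// ltrBlDr lerBrDr mulrC andbC//.
  rewrite !lebesgue_measure_itv/= !lte_fin ltr_nM2r ?invr_lt0// ltrD2r.
  case: ifP => _; last by rewrite mule0.
  rewrite ltr0_norm// -!EFinB -EFinM; congr EFin.
  by field; lra.
Qed.

Lemma normal_prob_scale (R : realType) (k : R) (A : set (measurableTypeR R)) :
  k != 0 -> measurable A ->
  normal_prob 0 1
    ((fun x : measurableTypeR R => k * x : measurableTypeR R) @^-1` A)
  = normal_prob 0 `|k| A.
Proof.
move=> k0 mA.
have nk0 : `|k| != 0 by rewrite normr_eq0.
pose f (x : measurableTypeR R) : measurableTypeR R := k * x.
have mf : measurable_fun setT f by exact: measurable_funM.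
(* Chosen so that [h (k * x)] is the standard normal density at [x]; the factor [|k|] cancels the
   Jacobian of the substitution. *)
pose h (y : measurableTypeR R) : \bar R := (`|k| * normal_pdf 0 `|k| y)%:E.
have mh : measurable_fun A h.
  apply/measurable_EFinP/measurable_funTS; apply: measurable_funM => //.
  exact: measurable_normal_pdf.
have h0 y : (0 <= h y)%E by rewrite lee_fin mulr_ge0 ?normal_pdf_ge0.
rewrite /normal_prob.
transitivity (\int[lebesgue_measure]_(x in f @^-1` A) (h \o f) x)%E.
  apply: eq_integral => x _; rewrite /h/= /f; congr EFin.
  rewrite !normal_pdfE// ?oner_neq0// /normal_peak /normal_fun !subr0.
  rewrite expr1n mul1r real_normK ?num_real// -(mulrnAr (k ^+ 2)).
  rewrite sqrtrM ?sqr_ge0//.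
  rewrite sqrtr_sqr mulrA; congr (_ * expR _).
    by field; rewrite nk0 /= gt_eqF// sqrtr_gt0 mulrn_wgt0// pi_gt0.
  by field.
rewrite -(ge0_integral_pushforward mf)//.
pose m := mscale (NngNum (normr_ge0 k^-1)) (@lebesgue_measure R).
rewrite (eq_measure_integral m) => [|B mB _]; last first.
  rewrite /m/= /mscale/= /pushforward normfV -(lebesgue_measure_affine 0)//.
  by congr lebesgue_measure; apply/seteqP; split => x /=; rewrite addr0.
rewrite ge0_integral_mscale//= -ge0_integralZl//.
by apply: eq_integral => x _; rewrite /h -EFinM normfV mulrA mulVf// mul1r.
Qed.

(** * Uniqueness for the dyadic functional equation *)

Lemma eq0_le_pow2 (R : realType) (x : R) :
  (forall n : nat, `|x| <= 2 ^- n) -> x = 0.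
Proof.
move=> xn; apply/eqP; rewrite -normr_le0 leNgt; apply/negP => x0.
have := upper_nthrootP (leqnn (Num.bound `|x|^-1)); apply/negP; rewrite -leNgt.
by rewrite -[leLHS]invrK lef_pV2 ?posrE ?invr_gt0 ?exprn_gt0.
Qed.

(* One of the two terms of the average vanishes, so the bound on h halves at
   each step; the argument is run first on the boundary b = -1. *)
Lemma dyadic_contraction_eq0 (R : realType) (h : R -> R -> R) :
  (forall a b, h a b = 2^-1 * (h b (2 * a - 1) + h b (2 * a))) ->
  (forall a b, `|h a b| <= 1) ->
  (forall a b, 1 <= b -> h a b = 0) ->
  (forall a b, b < 0 -> h a b = h a (-1)) ->
  h (-1) (-1) = 0 ->
  forall a b, h a b = 0.
Proof.
move=> hE h1 h0 hN hNN.
have halve (x y : R) n :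
    `|x| <= 2 ^- n -> y = 0 -> `|2^-1 * (y + x)| <= 2 ^- n.+1.
  move=> xn ->; rewrite add0r normrM gtr0_norm ?invr_gt0// exprS invfM.
  by rewrite ler_pM2l ?invr_gt0.
(* At first argument [-1] both averaged terms have a negative second argument, -3 or -2, so both
   equal [h a (-1)]. *)
have hNa a : h (-1) a = h a (-1) by rewrite hE !(hN a (_ * _)) ?hN; lra.
have margin a : h a (-1) = 0.
  apply: eq0_le_pow2 => n; elim: n a => [|n IH] a.
    by rewrite expr0 invr1; exact: h1.
  (* Below 1/2, [2 * a - 1] is negative and its term reduces to [h (-1) (-1) = 0]; from 1/2 on,
     [2 * a] is at least 1 and its term vanishes. *)
  rewrite hE; have [a2|a2] := ltP a 2^-1.
    by apply: halve; [rewrite hNa; exact: IH|rewrite hN ?hNN//; lra].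
  rewrite addrC; apply: halve; [rewrite hNa; exact: IH|rewrite h0//; lra].
move=> a b; apply: eq0_le_pow2 => n; elim: n a b => [|n IH] a b.
  by rewrite expr0 invr1; exact: h1.
rewrite hE; have [a2|a2] := ltP a 2^-1.
  by apply: halve; [exact: IH|rewrite hN ?margin//; lra].
by rewrite addrC; apply: halve; [exact: IH|rewrite h0//; lra].
Qed.

(** * Even and odd binary digits *)

Section Digits.
Context {R : realType}.
Local Notation T := (measurableTypeR R).

Definition unif01 : probability T R := uniform_prob (@ltr01 R).

(** The endpoint 1, a null set, is dropped because [doubling] maps each half of [[0, 1[] onto [[0,
    1[]. *)
Lemma unif01E (A : set T) : measurable A ->
  unif01 A = lebesgue_measure (A `&` `[0%R, 1%R[%classic).
Proof.
move=> mA; rewrite /unif01/= /uniform_prob integral_uniform_pdf.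
transitivity (\int[lebesgue_measure]_(x in `[0%R, 1%R]) (\1_A x)%:E)%E.
  rewrite integral_mkcondl; apply: eq_integral => x.
  rewrite inE/= in_itv/= patchE indicE /uniform_pdf => ->.
  by rewrite subr0 invr1; case: ifP.
rewrite -integral_itv_bndo_bndc ?integral_indic//.
by apply/measurable_EFinP/measurable_indic.
Qed.

Lemma unif01_ray_lt0 (a : R) : a < 0 -> unif01 `]a, +oo[%classic = 1%E.
Proof.
move=> a0; rewrite unif01E// setIidr ?lebesgue_measure_itv/= ?lte01 ?sube0//.
by move=> x /=; rewrite !in_itv/= andbT => /andP[/(lt_le_trans a0)].
Qed.

Lemma unif01_ray_ge1 (a : R) : 1 <= a -> unif01 `]a, +oo[%classic = 0%E.
Proof.
move=> a1; rewrite unif01E// (_ : _ `&` _ = set0) ?measure0//.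
apply/seteqP; split=> x //=; rewrite !in_itv/= andbT => -[ax /andP[_ x1]].
by have := lt_trans (le_lt_trans a1 ax) x1; rewrite ltxx.
Qed.

Definition digit (x : R) : bool := 2^-1 <= x.

(** On [[0, 1[] this is multiplication by 2 modulo 1, the shift of binary expansions. *)
Definition doubling (x : T) : T := 2 * x - (digit x)%:R.

Lemma measurable_digit : measurable_fun [set: T] digit.
Proof. exact: measurable_fun_ler. Qed.

Lemma measurable_doubling : measurable_fun [set: T] doubling.
Proof.
apply: measurable_funB; first exact: measurable_funM.
rewrite (_ : (fun _ => _) = (fun x => if digit x then 1 else 0)).
  by apply: measurable_fun_ifT => //; exact: measurable_digit.
by apply/funext => x; case: digit.
Qed.

(** The first digit is a fair coin independent of the remaining digits: where it equals [i], the
    shift is the affine map [2 * x - i], which accounts for the factor 1/2. *)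
Lemma unif01_digit (i : bool) (C : set T) : measurable C ->
  unif01 (digit @^-1` [set i] `&` doubling @^-1` C) = (2^-1%:E * unif01 C)%E.
Proof.
move=> mC; rewrite !unif01E//; last first.
  apply: measurableI.
    by rewrite -[X in measurable X]setTI; exact: measurable_digit.
  by rewrite -[X in measurable X]setTI; exact: measurable_doubling.
rewrite -[in RHS](@gtr0_norm _ 2)// -(lebesgue_measure_affine (- i%:R))//;
  last first.
  exact: measurableI.
congr lebesgue_measure; apply/seteqP.
split=> x /=; rewrite !in_itv/= /doubling /digit; case: i;
  case: (leP 2^-1 x) => /= x2.
- by move=> [[_ Cx] x01]; split => //; lra.
- by case=> -[].
- by case=> -[].
- by move=> [[_ Cx] x01]; split => //; lra.
- by move=> [Cx x01]; split => //; lra.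
- by move=> [Cx x01]; exfalso; lra.
- by move=> [Cx x01]; exfalso; lra.
- by move=> [Cx x01]; split => //; lra.
Qed.

Lemma unif01_split (C : bool -> set T) : (forall i, measurable (C i)) ->
  unif01 [set x | C (digit x) (doubling x)] =
  (2^-1%:E * unif01 (C true) + 2^-1%:E * unif01 (C false))%E.
Proof.
move=> mC; rewrite -(unif01_digit true (mC _)) -(unif01_digit false (mC _)).
rewrite -measureU//; first last.
- by apply/seteqP; split=> x //= [[-> _] []].
- by apply: measurableI; rewrite -[X in measurable X]setTI;
    [exact: measurable_digit|exact: measurable_doubling].
- by apply: measurableI; rewrite -[X in measurable X]setTI;
    [exact: measurable_digit|exact: measurable_doubling].
congr (unif01 _); apply/seteqP; split => x /=; last by case=> -[->].
by case: digit; [left|right].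
Qed.
End Digits.

Section EvenOddDigits.
Context {R : realType}.
Local Notation T := (measurableTypeR R).
Local Notation unif01 := (@unif01 R).

(* [digit_sum n x] is the sum over j < n of d_{2j} / 2^{j+1}, where d_0, d_1,
   ... are the binary digits of x. *)
Fixpoint digit_sum (n : nat) (x : T) : T :=
  if n is m.+1 then ((digit x)%:R + digit_sum m (doubling (doubling x))) / 2
  else 0.

Definition even_digits (x : T) : T := limn (digit_sum ^~ x).

Definition odd_digits (x : T) : T := even_digits (doubling x).

Lemma digit_sum_bound n x : 0 <= digit_sum n x <= 1.
Proof.
elim: n x => [|n IH] x /=; first by rewrite lexx ler01.
by have := IH (doubling (doubling x)); case: digit => /=; lra.
Qed.

Lemma digit_sum_nd x : nondecreasing_seq (digit_sum ^~ x).
Proof.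
apply/nondecreasing_seqP => n; elim: n x => [|n IH] x.
  by have /andP[] := digit_sum_bound 1 x.
by apply: ler_wpM2r; rewrite ?invr_ge0// lerD2l; exact: IH.
Qed.

Lemma cvg_digit_sum x : digit_sum n x @[n --> \oo] --> even_digits x.
Proof.
apply: nondecreasing_is_cvgn; first exact: digit_sum_nd.
by exists 1 => _ [n _ <-]; have /andP[] := digit_sum_bound n x.
Qed.

Lemma even_digits_bound x : 0 <= even_digits x <= 1.
Proof.
have cvx : cvgn (digit_sum ^~ x).
  by apply/cvg_ex; exists (even_digits x); exact: cvg_digit_sum.
apply/andP; split.
  by apply: limr_ge => //; apply: nearW => n; have /andP[] := digit_sum_bound n x.
by apply: limr_le => //; apply: nearW => n; have /andP[] := digit_sum_bound n x.
Qed.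

(** After the leading digit, the other even-indexed digits of [x] are the odd-indexed digits of its
    shift. *)
Lemma even_digitsE x :
  even_digits x = ((digit x)%:R + odd_digits (doubling x)) / 2.
Proof.
have cS : digit_sum n.+1 x @[n --> \oo] --> even_digits x.
  by rewrite (cvg_shiftS (digit_sum ^~ x)); exact: cvg_digit_sum.
rewrite -(cvg_lim _ cS)//; apply/cvg_lim => //=.
by apply: cvgMl; apply: cvgD; [exact: cvg_cst|exact: cvg_digit_sum].
Qed.

Lemma measurable_even_digits : measurable_fun [set: T] even_digits.
Proof.
apply: (@measurable_fun_cvg _ _ _ _ digit_sum) => [n|x _]; last first.
  exact: cvg_digit_sum.
elim: n => [|n IH] /=; first exact: measurable_cst.
apply: measurable_funM => //; apply: measurable_funD.
  rewrite (_ : (fun _ => _) = (fun x => if digit x then 1 else 0)).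
    by apply: measurable_fun_ifT => //; exact: measurable_digit.
  by apply/funext => x; case: digit.
apply: (measurableT_comp IH); apply: (measurableT_comp measurable_doubling).
exact: measurable_doubling.
Qed.

Lemma measurable_odd_digits : measurable_fun [set: T] odd_digits.
Proof. exact: measurableT_comp measurable_even_digits measurable_doubling. Qed.

Let F (a b : R) :=
  fine (unif01 (even_digits @^-1` `]a, +oo[ `&` odd_digits @^-1` `]b, +oo[)).

Let c (a : R) := fine (unif01 `]a, +oo[%classic).

Let mE (a b : R) :
  measurable (even_digits @^-1` `]a, +oo[ `&` odd_digits @^-1` `]b, +oo[).
Proof.
apply: measurableI; rewrite -[X in measurable X]setTI.
  exact: measurable_even_digits.
exact: measurable_odd_digits.
Qed.

Let fin_unif (A : set T) : measurable A -> unif01 A = (fine (unif01 A))%:E.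
Proof. by move=> mA; rewrite fineK// fin_num_measure. Qed.

Let fine_split (C : bool -> set T) : (forall i, measurable (C i)) ->
  fine (unif01 [set x | C (digit x) (doubling x)]) =
  2^-1 * (fine (unif01 (C true)) + fine (unif01 (C false))).
Proof.
move=> mC; rewrite unif01_split//.
rewrite [unif01 (C true)]fin_unif// [unif01 (C false)]fin_unif//=.
by rewrite mulrDr.
Qed.

Let cE a : c a = 2^-1 * (c (2 * a - 1) + c (2 * a)).
Proof.
rewrite /c; pose C (i : bool) : set T := `](2 * a - i%:R), +oo[%classic.
have := @fine_split C (fun i => measurable_itv _); rewrite /C /= subr0 => <-.
congr (fine (unif01 _)); apply/seteqP; split => x /=;
  rewrite !in_itv/= !andbT /doubling;
  case: digit => /=; lra.
Qed.

(** Conditioning on the first digit exchanges the two numbers: the odd digits of [x] are the even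
    digits of [y = doubling x], and the even digits of [x] exceed [a] iff the odd digits of [y]
    exceed [2 * a] minus the first digit of [x]. *)
Let FE a b : F a b = 2^-1 * (F b (2 * a - 1) + F b (2 * a)).
Proof.
rewrite /F; pose C (i : bool) : set T :=
  even_digits @^-1` `]b, +oo[ `&` odd_digits @^-1` `](2 * a - i%:R), +oo[.
have := @fine_split C (fun i => mE _ _); rewrite /C /= subr0 => <-.
congr (fine (unif01 _)); apply/seteqP; split => x /=;
  rewrite !in_itv/= !andbT (even_digitsE x) -/(odd_digits x).
  by move=> [ax bx]; split => //; lra.
by move=> [bx ax]; split => //; lra.
Qed.

Let c_ge1 a : 1 <= a -> c a = 0.
Proof. by move=> a1; rewrite /c unif01_ray_ge1. Qed.

Let c_lt0 a : a < 0 -> c a = 1.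
Proof. by move=> a0; rewrite /c unif01_ray_lt0. Qed.

Let F_prob a b : 0 <= F a b <= 1.
Proof.
rewrite -!lee_fin /F -fin_unif; last exact: mE.
by rewrite measure_ge0 probability_le1//; exact: mE.
Qed.

Let c_prob a : 0 <= c a <= 1.
Proof. by rewrite -!lee_fin /c -fin_unif// measure_ge0 probability_le1. Qed.

Let F_ge1 a b : 1 <= b -> F a b = 0.
Proof.
move=> b1; rewrite /F (_ : _ `&` _ = set0) ?measure0//.
apply/seteqP; split=> x //=; rewrite !in_itv/= !andbT => -[_] bx.
by have := even_digits_bound (doubling x); rewrite -/(odd_digits x); lra.
Qed.

Let F_lt0 a b : b < 0 -> F a b = F a (-1).
Proof.
move=> b1; rewrite /F; congr (fine (unif01 _)); apply/seteqP; split=> x /=;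
  rewrite !in_itv/= !andbT => -[ax _]; split => //;
  have := even_digits_bound (doubling x); rewrite -/(odd_digits x); lra.
Qed.

Let F_NN : F (-1) (-1) = 1.
Proof.
rewrite /F (_ : _ `&` _ = setT) ?probability_setT//.
apply/seteqP; split=> x //= _.
rewrite !in_itv/= !andbT; split.
  by have := even_digits_bound x; lra.
by have := even_digits_bound (doubling x); rewrite -/(odd_digits x); lra.
Qed.

(** As [c] is the tail of the uniform law itself, this yields uniformity of both numbers together
    with their independence. *)
Let F_prod a b : F a b = c a * c b.
Proof.
apply/eqP; rewrite -subr_eq0; apply/eqP; move: a b.
apply: (@dyadic_contraction_eq0 R (fun a b => F a b - c a * c b)) =>
  [a b|a b|a b b1|a b b0|].
- by rewrite FE cE; ring.
- have := F_prob a b; have := c_prob a; have := c_prob b => cb ca Fab.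
  rewrite ler_norml; nra.
- by rewrite F_ge1// (c_ge1 b1) mulr0 subr0.
- by rewrite F_lt0// (c_lt0 b0) (c_lt0 (ltrN10 R)).
- by rewrite F_NN (c_lt0 (ltrN10 R)) mulr1 subrr.
Qed.

(** Rays are replaced by Borel sets one coordinate at a time, the other coordinate being fixed so
    that both sides are finite measures determined by their values on rays. *)
Lemma even_odd_digits_indep (A B : set T) : measurable A -> measurable B ->
  unif01 (even_digits @^-1` A `&` odd_digits @^-1` B) =
  (unif01 A * unif01 B)%E.
Proof.
move=> mA mB.
have mev C : measurable C -> measurable (even_digits @^-1` C).
  move=> mC; rewrite -[X in measurable X]setTI.
  exact: measurable_even_digits.
have mod C : measurable C -> measurable (odd_digits @^-1` C).
  by move=> mC; rewrite -[X in measurable X]setTI; exact: measurable_odd_digits.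
have unif_nng (C : set T) : 0 <= fine (unif01 C) by rewrite fine_ge0.
have ray a : unif01 (even_digits @^-1` A `&` odd_digits @^-1` `]a, +oo[) =
    (unif01 A * unif01 `]a, +oo[%classic)%E.
  pose D : set T := odd_digits @^-1` `]a, +oo[.
  have mD : measurable D by exact: mod.
  pose m1 : {measure set T -> \bar R} :=
    pushforward (mrestr unif01 mD) even_digits.
  pose m2 : {measure set T -> \bar R} :=
    mscale (NngNum (unif_nng `]a, +oo[%classic)) unif01.
  have := @measure_unique_ray R (m1 measurable_even_digits) m2.
  rewrite /m1/= /m2/= /mscale/= /pushforward/= /mrestr/= => ->//.
  - by rewrite -fin_unif// muleC.
  - by rewrite setTI; apply: le_lt_trans (probability_le1 _ _) (ltry _).
  - move=> x; rewrite [LHS]fin_unif; last exact: mE.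
    rewrite -/(F x a) F_prod mulrC EFinM; congr (_ * _)%E.
    by rewrite -[RHS]/(unif01 _) fin_unif.
pose D : set T := even_digits @^-1` A.
have mD : measurable D by exact: mev.
rewrite setIC.
pose m1 : {measure set T -> \bar R} :=
  pushforward (mrestr unif01 mD) odd_digits.
pose m2 : {measure set T -> \bar R} := mscale (NngNum (unif_nng A)) unif01.
have := @measure_unique_ray R (m1 measurable_odd_digits) m2.
rewrite /m1/= /m2/= /mscale/= /pushforward/= /mrestr/= => ->//.
- by rewrite -fin_unif.
- by rewrite setTI; apply: le_lt_trans (probability_le1 _ _) (ltry _).
- by move=> x; rewrite setIC ray -fin_unif.
Qed.

End EvenOddDigits.

(** * Independent normal variables *)

Section Quantile.
Context {R : realType}.
Local Notation T := (measurableTypeR R).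
Variable mu : probability T R.

Let Phi (x : R) : R := fine (mu `]-oo, x]%classic).

(** The generalized inverse of the distribution function; the default value 0 is taken only outside
    []0, 1[], a null set for the uniform law. *)
Definition quantile (u : T) : T :=
  if (0 < u) && (u < 1) then inf [set x | u <= Phi x] else 0.

(** The identity becomes a random variable of law [mu], so that the general facts on [cdf] apply to
    [Phi]. *)
Let idT : T -> R := idfun.
Let idT_mfun := @isMeasurableFun.Build _ _ T R idT (@measurable_id _ _ setT).
Let idRV : {RV mu >-> R} := HB.pack_for {RV mu >-> R} idT idT_mfun.

Let muE (x : R) : mu `]-oo, x]%classic = cdf idRV x.
Proof. by []. Qed.

Let cvg_PhiNy : Phi x @[x --> -oo%R] --> (0 : R).
Proof. exact: (fine_cvg (cvg_cdfNy0 idRV)). Qed.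

Let cvg_Phiy : Phi x @[x --> +oo%R] --> (1 : R).
Proof. exact: (fine_cvg (cvg_cdfy1 idRV)). Qed.

Let cvg_Phi_right a : Phi x @[x --> a^'+] --> Phi a.
Proof.
apply: fine_cvg; rewrite fineK ?fin_num_measure//.
exact: (cdf_right_continuous (X := idRV)).
Qed.

Let Phi_nd x y : x <= y -> Phi x <= Phi y.
Proof.
by move=> xy; rewrite fine_le ?fin_num_measure// !muE; exact: cdf_nondecreasing.
Qed.

Let Phi_prob x : 0 <= Phi x <= 1.
Proof.
by rewrite -!lee_fin /Phi fineK ?fin_num_measure// measure_ge0 probability_le1.
Qed.

(** A Galois connection: the limits of [Phi] at infinity make the infimum finite, and right
    continuity makes it attained. *)
Let quantile_le u x : 0 < u < 1 -> (quantile u <= x) = (u <= Phi x).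
Proof.
move=> /andP[u0 u1]; rewrite /quantile u0 u1 /=.
have [y Phiy] := filter_ex (cvgr_lt 0 cvg_PhiNy _ u0).
have [z Phiz] := filter_ex (cvgr_gt 1 cvg_Phiy _ u1).
have Slb : has_lbound [set x | u <= Phi x].
  exists y => s /= us; rewrite leNgt; apply/negP => /ltW/Phi_nd sy.
  by have := le_lt_trans (le_trans us sy) Phiy; rewrite ltxx.
have Sinf : has_inf [set x | u <= Phi x] by split => //; exists z; exact: ltW.
apply/idP/idP => [qx|ux]; last exact: ge_inf.
apply: (cvgr_to_ge (@cvg_Phi_right x)).
near=> y'.
have /(inf_lt Sinf.1)[s /= us sy'] : inf [set x | u <= Phi x] < y'.
  by apply: le_lt_trans qx _; near: y'; exact: nbhs_right_gt.
exact: le_trans us (Phi_nd (ltW sy')).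
Unshelve. all: by end_near. Qed.

Lemma measurable_quantile : measurable_fun [set: T] quantile.
Proof.
apply: (measurability (@RGenOInfty.G R)) => [|/= _ [_] [r] -> <-].
  exact: RGenOInfty.measurableE.
(* Outside []0, 1[] the default value 0 lies above [r] exactly when [r < 0]. *)
rewrite (_ : _ `&` _ = (`]0%R, 1%R[%classic `&` `]Phi r, +oo[%classic) `|`
  (~` `]0%R, 1%R[%classic `&` (if r < 0 then setT else set0))).
  apply: measurableU; first exact: measurableI.
  apply: measurableI; first exact: measurableC.
  by case: ifP.
apply/seteqP; split => u /=; rewrite !in_itv/= !andbT.
  move=> [_]; have [u01|u01] := boolP (0 < u < 1).
    by rewrite !ltNge quantile_le// => ?; left.
  rewrite /quantile (negbTE u01) => ->; by right.
move=> [[u01]|[/negP u01]].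
  by rewrite !ltNge quantile_le.
by rewrite /quantile (negbTE u01); case: ifP.
Qed.

Lemma unif01_quantile (A : set T) : measurable A ->
  unif01 (quantile @^-1` A) = mu A.
Proof.
pose m : {measure set T -> \bar R} := pushforward unif01 quantile.
apply: (@measure_unique_ray R (m measurable_quantile) mu).
  by rewrite /m/= /pushforward preimage_setT probability_setT ltry.
have mq : measurable_fun setT quantile := measurable_quantile.
move=> x; rewrite /m/= /pushforward.
have mpre : measurable (quantile @^-1` `]x, +oo[).
  by rewrite -[X in measurable X]setTI; exact: mq.
rewrite -[LHS]/(unif01 _) unif01E//.
set S := quantile @^-1` _ `&` _.
(* The point 0, where [quantile] takes its default value, is split off as a null set. *)
have -> : S = `](Phi x), 1%R[%classic `|` (S `&` [set 0%R]).
  apply/seteqP; split => u /=; rewrite /S/= !in_itv/= !andbT.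
    move=> [xq /andP[u0 u1]].
    have [u_eq0|u_neq0] := eqVneq u 0; first by right; rewrite u0 u1.
    have {}u0 : 0 < u by rewrite lt_neqAle eq_sym u_neq0.
    by left; rewrite u1 andbT ltNge -quantile_le ?u0// -ltNge.
  move=> [/andP[xu u1]|[]//].
  have u0 : 0 < u by apply: le_lt_trans xu; have /andP[] := Phi_prob x.
  by rewrite (ltW u0) u1 ltNge quantile_le ?u0// -ltNge.
rewrite measureU0//.
- rewrite -[LHS]/(lebesgue_measure _) lebesgue_measure_itv/= lte_fin.
  rewrite -setCitvl probability_setC//.
  rewrite -[X in (_ - X)%E]fineK ?fin_num_measure// -/(Phi x) -EFinB.
  have [//|] := ltP (Phi x) 1.
  by move=> Phi1; congr EFin; have := Phi_prob x; lra.
- by apply: measurableI => //; exact: measurableI.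
- apply: (@subset_measure0 _ _ _ lebesgue_measure _ [set 0%R]) => //.
  + by apply: measurableI => //; exact: measurableI.
  + exact: lebesgue_measure_set1.
Qed.

End Quantile.

(** * Independent observations along the orbit of a map *)

Section IidSequence.
Context d (Om : measurableType d) d' (T' : measurableType d') (R : realType).
Variables (P : probability Om R) (X : Om -> T') (S : Om -> Om).
Hypotheses (mX : measurable_fun setT X) (mS : measurable_fun setT S).
Hypothesis indep : forall A B, measurable A -> measurable B ->
  P (X @^-1` A `&` S @^-1` B) = (P (X @^-1` A) * P B)%E.

Definition orbit_obs (n : nat) (w : Om) : T' := X (iter n S w).

Definition past (n : nat) : set (set Om) :=
  \bigcup_(s in `I_n) preimage_set_system setT (orbit_obs s) measurable.

Let miter n : measurable_fun setT (iter n S).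
Proof.
by elim: n => [|n IH]; [exact: measurable_id|exact: measurableT_comp mS IH].
Qed.

Lemma measurable_orbit_obs n : measurable_fun setT (orbit_obs n).
Proof. exact: measurableT_comp mX (miter n). Qed.

Let mpre n B : measurable B -> measurable (iter n S @^-1` B).
Proof. by move=> mB; rewrite -[X in measurable X]setTI; exact: miter. Qed.

Let mobs n B : measurable B -> measurable (orbit_obs n @^-1` B).
Proof.
by move=> mB; rewrite -[X in measurable X]setTI; exact: measurable_orbit_obs.
Qed.

(* A pi-system generating the past, stable under one more observation. *)
Fixpoint cylinders (n : nat) : set (set Om) :=
  if n is m.+1 then
    [set A | exists A' B, [/\ cylinders m A', measurable B &
                             A = A' `&` orbit_obs m @^-1` B]]
  else [set setT].

Let cylinders_setT n : cylinders n setT.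
Proof.
elim: n => //= n IH; exists setT, setT; split=> //.
by rewrite preimage_setT setIT.
Qed.

Let cylinders_setI n : setI_closed (cylinders n).
Proof.
elim: n => [|n IH] /= A B; first by move=> -> ->; rewrite setIT.
move=> [A' [C [cA mC ->]]] [B' [D [cB mD ->]]].
exists (A' `&` B'), (C `&` D); split; [exact: IH|exact: measurableI|].
by rewrite preimage_setI setIACA.
Qed.

Let cylinders_measurable n : cylinders n `<=` measurable.
Proof.
elim: n => [|n IH] /= A; first by move=> ->.
by move=> [A' [C [cA mC ->]]]; apply: measurableI; [exact: IH|exact: mobs].
Qed.

Let past_cylinders n : past n `<=` cylinders n.
Proof.
move=> _ [s /= sn [B mB <-]]; rewrite setTI.
elim: n sn => // n IH; rewrite ltnS leq_eqVlt => /predU1P[->|/IH cn] /=.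
  by exists setT, B; split=> //; rewrite setTI.
by exists (orbit_obs s @^-1` B), setT; split=> //; rewrite preimage_setT setIT.
Qed.

Lemma past_measurable n A : <<s past n >> A -> measurable A.
Proof.
apply: smallest_sub; first exact: sigma_algebra_measurable.
by move=> B /past_cylinders/cylinders_measurable.
Qed.

(** Hypothesis [indep] also contains the invariance of [P] under [S] (take [A = setT]). In the
    induction, the last observation and the next iterate are the pullback by [iter n S] of one
    event, which [indep] factors. *)
Let cylinders_indep n A B : cylinders n A -> measurable B ->
  P (A `&` iter n S @^-1` B) = (P A * P B)%E.
Proof.
elim: n A B => [|n IH] A B /=.
  by move=> -> mB; rewrite probability_setT mul1e setTI.
move=> [A' [C [cA mC ->]]] mB.
have mXC : measurable (X @^-1` C).
  by rewrite -[X in measurable X]setTI; exact: mX.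
have mSB : measurable (S @^-1` B).
  by rewrite -[X in measurable X]setTI; exact: mS.
rewrite -setIA (_ : _ `&` iter n.+1 S @^-1` B =
  iter n S @^-1` (X @^-1` C `&` S @^-1` B))//.
rewrite IH//; last exact: measurableI.
(* The induction hypothesis is used a second time, backwards, to absorb the last observation into
   the cylinder. *)
by rewrite indep// muleA; congr (_ * _)%E; exact/esym/IH.
Qed.

(** For fixed [B] both sides are finite measures in [A] that agree on the pi-system of cylinders. *)
Lemma past_indep n A B : <<s past n >> A -> measurable B ->
  P (A `&` iter n S @^-1` B) = (P A * P B)%E.
Proof.
move=> pA mB; have mnB : measurable (iter n S @^-1` B) by exact: mpre.
have PB0 : (0 <= fine (P B))%R by rewrite fine_ge0.
pose m2 : {measure set Om -> \bar R} := mscale (NngNum PB0) P.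
pose m1 : {measure set Om -> \bar R} := mrestr P mnB.
have E C : m2 C = (P C * P B)%E.
  by rewrite /m2/= /mscale/= fineK ?fin_num_measure// muleC.
rewrite -[LHS]/(m1 A) -E.
apply: (@g_sigma_algebra_measure_unique _ _ _ (cylinders n) _ (fun=> setT)) => //.
- by rewrite bigcup_const//; exists 0%N.
- by move=> C cC; rewrite E; exact: cylinders_indep.
- move=> _; apply: le_lt_trans (probability_le1 P _) (ltry _).
  by rewrite setTI.
- by apply: sub_sigma_algebra2 pA; exact: past_cylinders.
Qed.

Lemma orbit_obs_indep n A C : <<s past n >> A -> measurable C ->
  P (A `&` orbit_obs n @^-1` C) = (P A * P (X @^-1` C))%E.
Proof.
move=> pA mC; rewrite -(past_indep pA)//.
by rewrite -[X in measurable X]setTI; exact: mX.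
Qed.

End IidSequence.

(** A normal variable is read off the even digits, while the odd digits form a fresh uniform number
    from which the next variables are read. *)
Lemma iid_normal (R : realType) :
  exists g : nat -> measurableTypeR R -> measurableTypeR R,
  [/\ forall n, measurable_fun setT (g n),
      forall n A,
        <<s \bigcup_(s in `I_n)
              preimage_set_system setT (g s) measurable >> A ->
        measurable A &
      forall n A B,
        <<s \bigcup_(s in `I_n)
              preimage_set_system setT (g s) measurable >> A ->
        measurable B ->
        unif01 (A `&` g n @^-1` B) = (unif01 A * normal_prob 0 1 B)%E].
Proof.
pose X := quantile (normal_prob (0:R) 1) \o even_digits.
have mX : measurable_fun setT X.
  apply: measurableT_comp; first exact: measurable_quantile.
  exact: measurable_even_digits.
have mq A : measurable A -> measurable (quantile (normal_prob (0:R) 1) @^-1` A).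
  by move=> mA; rewrite -[X in measurable X]setTI; exact: measurable_quantile.
have even_unif A : measurable A -> unif01 (even_digits @^-1` A) = unif01 A.
  move=> mA; have := even_odd_digits_indep mA measurableT.
  by rewrite preimage_setT setIT probability_setT mule1.
have XE A : measurable A -> unif01 (X @^-1` A) = normal_prob 0 1 A.
  by move=> mA; rewrite comp_preimage even_unif ?unif01_quantile//; exact: mq.
have indep (A B : set (measurableTypeR R)) : measurable A -> measurable B ->
    unif01 (X @^-1` A `&` odd_digits @^-1` B) =
    (unif01 (X @^-1` A) * unif01 B)%E.
  move=> mA mB; rewrite [X @^-1` A]comp_preimage.
  by rewrite even_odd_digits_indep ?even_unif//; exact: mq.
exists (orbit_obs X odd_digits); split.
- by move=> n; apply: measurable_orbit_obs => //; exact: measurable_odd_digits.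
- by move=> n A; apply: past_measurable => //; exact: measurable_odd_digits.
- move=> n A B pA mB; rewrite -XE//.
  by apply: orbit_obs_indep => //; exact: measurable_odd_digits.
Qed.

Lemma g_sigma_algebraT (T : Type) (G : set (set T)) : <<s G >> [set: T].
Proof.
have [G0 GC _] := smallest_sigma_algebra [set: T] G.
by have := GC _ G0; rewrite setD0.
Qed.

(** * The bandit instance *)

Section Instance.
Context {R : realType}.

Definition arm_obs (k : 'I_3) : R := nth 0 [:: 0; 1; -1] k.

Definition arm_features (k : 'I_3) : 'cV[R]_(1 + 1) :=
  col_mx (arm_obs k)%:M (k == ord0)%:R%:M.

Definition arm_param : 'cV[R]_(1 + 1) := col_mx 0 1%:M.

Definition arm_pos : 'I_3 := @Ordinal 3 1 isT.

Definition arm_neg : 'I_3 := @Ordinal 3 2 isT.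

Lemma dot11 (u w : 'cV[R]_1) : dot u w = u ord0 ord0 * w ord0 ord0.
Proof. by rewrite /dot mxE big_ord1 mxE. Qed.

Lemma dot_arm_param (k : 'I_3) :
  dot (arm_features k) arm_param = (k == ord0)%:R.
Proof.
rewrite /dot /arm_features /arm_param tr_col_mx mul_row_col mulmx0 add0r mulmx1.
by rewrite tr_scalar_mx mxE eqxx.
Qed.

Lemma dotC n (u w : 'cV[R]_n) : dot u w = dot w u.
Proof. by rewrite /dot !mxE; apply: eq_bigr => i _; rewrite !mxE mulrC. Qed.

Lemma dotBr n (u w1 w2 : 'cV[R]_n) : dot u (w1 - w2) = dot u w1 - dot u w2.
Proof. by rewrite /dot mulmxBr !mxE. Qed.

Lemma observed_arm k : observed arm_features k = (arm_obs k)%:M.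
Proof. by rewrite /observed /arm_features col_mxKu. Qed.

Lemma gram_arm lambda (a : nat -> 'I_3) t :
  gram lambda (observed arm_features) a t =
  (lambda + \sum_(s < t) arm_obs (a s) ^+ 2)%:M.
Proof.
rewrite /gram raddfD/=; congr (_ + _); rewrite raddf_sum/=.
apply: eq_bigr => s _; rewrite observed_arm tr_scalar_mx -scalar_mxM.
by rewrite expr2.
Qed.

Lemma qform_scalar (c x : R) : qform (c%:M : 'M[R]_1) x%:M = c * x ^+ 2.
Proof. by rewrite /qform dot11 -scalar_mxM !mxE eqxx !mulr1n mulrCA expr2. Qed.

(** * Neither algorithm plays the optimal arm *)

Section NeverOptimal.
Context d (Om : measurableType d) (P : probability Om R).
Variables (eps : nat -> {RV P >-> R}) (sigma : R).
Hypothesis sigma_gt0 : 0 < sigma.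

Lemma gram_scale_ge lambda (a : nat -> 'I_3) t :
  lambda <= lambda + \sum_(s < t) arm_obs (a s) ^+ 2.
Proof. by rewrite lerDl sumr_ge0// => s _; exact: sqr_ge0. Qed.

(** Strict positivity comes from the logarithm, whose argument exceeds 1 since the determinants have
    ratio at least 1 and [delta < 1]; the term in [S] may be 0. *)
Lemma oful_radius_gt0 lambda delta S (a : nat -> 'I_3) t :
  0 < lambda -> 0 < delta < 1 -> 0 <= S ->
  0 < oful_radius lambda (observed arm_features) sigma delta S a t.
Proof.
move=> l0 /andP[d0 d1] S0; rewrite /oful_radius ltr_pwDl//; last first.
  by rewrite mulr_ge0// sqrtr_ge0.
rewrite mulr_gt0// sqrtr_gt0 mulr_gt0// gram_arm !det_scalar !expr1.
set V := lambda + _; have lV : lambda <= V by exact: gram_scale_ge.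
have sl0 : 0 < Num.sqrt lambda by rewrite sqrtr_gt0.
apply: ln_gt0; rewrite ltr_pdivlMr// mul1r; apply: (lt_le_trans d1).
by rewrite ler_pdivlMr// mul1r ler_wsqrtr.
Qed.

Lemma oful_index_arm lambda delta S (a : nat -> 'I_3) (y : nat -> R) t k :
  oful_index lambda (observed arm_features) sigma delta S a y t k =
  arm_obs k * (ridge lambda (observed arm_features) a y t) ord0 ord0 +
  oful_radius lambda (observed arm_features) sigma delta S a t *
  Num.sqrt ((lambda + \sum_(s < t) arm_obs (a s) ^+ 2)^-1 * arm_obs k ^+ 2).
Proof.
rewrite /oful_index gram_arm invmx_scalar observed_arm qform_scalar dot11.
by rewrite mxE eqxx mulr1n.
Qed.

Lemma oful_run_neq0 lambda delta S (a : nat -> Om -> 'I_3) :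
  0 < lambda -> 0 < delta < 1 -> 0 <= S ->
  oful_run eps sigma arm_features arm_param lambda delta S a ->
  forall t w, a t w != ord0.
Proof.
move=> l0 d01 S0 run t w; apply/eqP => a0; have [_ /(_ w) amax _] := run t.
have := amax arm_pos; have := amax arm_neg; rewrite a0 !oful_index_arm.
set rho := oful_radius _ _ _ _ _ _ _; set V := lambda + _.
set r := ridge _ _ _ _ _ _ _.
have rho0 : 0 < rho by exact: oful_radius_gt0.
have V0 : 0 < V := lt_le_trans l0 (gram_scale_ge lambda (a^~ w) t).
have bonus : 0 < rho * Num.sqrt V^-1 by rewrite mulr_gt0// sqrtr_gt0 invr_gt0.
(* Optimality of arm 0 would give [r + bonus <= 0] and [- r + bonus <= 0]; their sum contradicts
   [bonus > 0]. *)
rewrite /arm_obs/= sqrrN expr1n expr0n/= !mulr1 mulr0 sqrtr0 mul0r mulr0 addr0.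
by lra.
Qed.

Lemma regret_arm (a : nat -> Om -> 'I_3) T w :
  regret arm_features arm_param ord0 a T w = \sum_(t < T) (a t w != ord0)%:R.
Proof.
rewrite /regret; apply: eq_bigr => t _.
rewrite dotBr ![dot arm_param _]dotC !dot_arm_param eqxx.
by case: eqP => _; rewrite /= ?subrr ?subr0.
Qed.

(** The countably many null sets are merged, so the regret is almost surely the constant [T]. The
    factor 1 is the constant [c] of the theorem. *)
Lemma expectation_regret_ge (a : nat -> Om -> 'I_3) T :
  (forall t k, measurable (a t @^-1` [set k])) ->
  (forall t, {ae P, forall w, a t w != ord0}) ->
  ((1 * T%:R)%:E <= 'E_P[regret arm_features arm_param ord0 a T])%E.
Proof.
move=> ma /ae_foralln ae_a; rewrite mul1r unlock.
have mT : measurable_fun setT (regret arm_features arm_param ord0 a T).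
  rewrite (_ : regret _ _ _ _ _ =
    fun w => \sum_(t < T) (1 - \1_(a t @^-1` [set ord0]) w)).
    apply: measurable_sum => t; exact: measurable_funB.
  apply/funext => w; rewrite regret_arm; apply: eq_bigr => t _.
  rewrite indicE; case: eqP => aw.
    by rewrite mem_set//= subrr.
  by rewrite memNset//= subr0.
rewrite (@ae_eq_integral _ _ _ P setT (cst (T%:R%:E))
  (EFin \o regret arm_features arm_param ord0 a T))//.
- by rewrite integral_cst//= probability_setT mule1.
- exact/measurable_EFinP.
- apply: filterS ae_a => w aw _ /=; congr EFin.
  rewrite regret_arm (eq_bigr (fun=> 1)) => [|t _]; last by rewrite aw.
  by rewrite sumr_const card_ord.
Qed.

(** Arm 0 is a maximizer only if the draw and its opposite are both at most 0, hence only if the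
    draw is 0; a normal law has no atom. *)
Lemma lints_run_neq0 v (a : nat -> Om -> 'I_3) (th : nat -> Om -> 'cV[R]_1) :
  lints_run eps sigma arm_features arm_param v a th ->
  forall t, {ae P, forall w, a t w != ord0}.
Proof.
move=> run t; have [_ mth gth amax _] := run t.
pose E := (fun w => dot (1%:M : 'cV[R]_1) (th t w)) @^-1` [set 0].
have mE : measurable E.
  rewrite -[X in measurable X]setTI.
  have : measurable_fun setT (fun w => dot (1%:M : 'cV[R]_1) (th t w)).
    under eq_fun do rewrite dot11.
    by apply: measurable_funM => //; exact: mth.
  by apply.
have PE : P E = 0%E.
  have u0 : (1%:M : 'cV[R]_1) != 0.
    apply/eqP => /matrixP /(_ ord0 ord0); rewrite !mxE eqxx.
    by apply/eqP; rewrite oner_eq0.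
  (* Integrating the conditional probability over the whole space gives [P E]. *)
  have [_ _ _ /(_ setT)] := gth _ u0 _ (measurable_set1 0).
  rewrite -/E integral_indic// setIT => ->; last first.
    exact: g_sigma_algebraT.
  apply: integral0_eq => w _; congr EFin.
  set m := dot _ (ridge _ _ _ _ _); set s := Num.sqrt _.
  have /null_content_dominatesP dom := normal_prob_dominates m s.
  have -> // : normal_prob m s [set 0] = 0%E.
  by apply: dom => //; exact: lebesgue_measure_set1.
exists E; split => // w /= /negP; rewrite negbK => /eqP aw.
have := amax w arm_pos; have := amax w arm_neg.
rewrite aw !observed_arm !dot11 !mxE !eqxx !mulr1n /arm_obs /= !mul0r /E/=.
rewrite dot11 mxE eqxx mulr1n; lra.
Qed.

End NeverOptimal.
End Instance.

(** * Constant conditional expectations *)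

Section ConditionalConstants.
Context d (Om : measurableType d) (R : realType) (P : probability Om R).
Implicit Types (G : set (set Om)) (E : set Om).

Lemma g_sigma_algebra_preimage_cst G (c : R) (B : set R) :
  <<s G >> ((fun=> c : R) @^-1` B : set Om).
Proof.
rewrite preimage_cst; case: ifP => _; first exact: g_sigma_algebraT.
exact: sigma_algebra0.
Qed.

Lemma is_cond_exp_cst G (c : R) : is_cond_exp P <<s G >> (fun=> c) (fun=> c).
Proof.
split=> //; try exact: finite_measure_integrable_cst.
by move=> B _; exact: g_sigma_algebra_preimage_cst.
Qed.

(** This reduces the Gaussian condition on a draw to independence when the conditional mean and
    variance are deterministic. *)
Lemma is_cond_exp_indep G E (p : R) :
  measurable E -> <<s G >> `<=` measurable ->
  (forall A, <<s G >> A -> P (A `&` E) = (P A * p%:E)%E) ->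
  is_cond_exp P <<s G >> \1_E (fun=> p).
Proof.
move=> mE mG indep; split.
- exact: integrable_indic.
- exact: finite_measure_integrable_cst.
- by move=> B _; exact: g_sigma_algebra_preimage_cst.
- move=> A GA; rewrite integral_indic//; last exact: mG.
  transitivity (P A * p%:E)%E; first by rewrite setIC; exact: indep.
  by rewrite integral_cst; [exact: muleC|exact: mG].
Qed.

Lemma cond_subgaussian0 G (sigma : R) :
  cond_subgaussian P sigma <<s G >> (fun=> 0).
Proof.
move=> l; exists (fun=> 1).
  rewrite (_ : (fun _ => expR _) = fun=> 1); first exact: is_cond_exp_cst.
  by apply/funext => w; rewrite mulr0 expR0.
apply: aeW => w; rewrite -[leLHS]expR0 ler_expR.
by rewrite divr_ge0// mulr_ge0// sqr_ge0.
Qed.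

End ConditionalConstants.

(** * Existence of an OFUL run *)

Section NoiselessRuns.
Context {R : realType}.
Context d (Om : measurableType d) (P : probability Om R).
Variable sigma : R.

Definition no_noise (t : nat) : {RV P >-> R} := cst 0.

Lemma reward_arm_neq0 (a : nat -> Om -> 'I_3) t w : a t w != ord0 ->
  reward no_noise arm_features arm_param a t w = 0.
Proof. by move=> aw; rewrite /reward dot_arm_param (negbTE aw) addr0. Qed.

Lemma ridge_reward0 lambda K n (x : 'I_K -> 'cV[R]_n) a (y : nat -> R) t :
  (forall s, y s = 0) -> ridge lambda x a y t = 0.
Proof.
by move=> y0; rewrite /ridge big1 ?mulmx0// => s _; rewrite y0 scale0r.
Qed.

(** All rewards are 0, so the estimate is 0 and the indices reduce to the bonuses, which arms 1 and
    2 maximize with a tie. *)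
Lemma oful_run_arm_pos lambda delta S :
  0 < sigma -> 0 < lambda -> 0 < delta < 1 -> 0 <= S ->
  oful_run no_noise sigma arm_features arm_param lambda delta S
    (fun _ _ => arm_pos).
Proof.
move=> sigma0 l0 d01 S0 t; split.
- by move=> k; rewrite preimage_cst; case: ifP.
- move=> w k; rewrite !oful_index_arm ridge_reward0; last first.
    by move=> s; rewrite reward_arm_neq0.
  rewrite mxE !mulr0 !add0r ler_wpM2l//; first exact/ltW/oful_radius_gt0.
  rewrite ler_wsqrtr// ler_wpM2l//.
    rewrite invr_ge0 (le_trans (ltW l0))//.
    exact: (gram_scale_ge lambda (fun=> arm_pos)).
  case: k => -[|[|[|//]]] ? /=; rewrite /arm_obs/= ?sqrrN// expr0n expr1n//.
- exact: cond_subgaussian0.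
Qed.

End NoiselessRuns.

(** * Existence of a LinTS run *)

Section NoiselessThompson.
Context {R : realType}.
Local Notation T := (measurableTypeR R).
Context d (Om : measurableType d) (P : probability Om R).
Variables (g : nat -> Om -> T) (sigma v : R).
Hypothesis v_gt0 : 0 < v.

Let past (n : nat) : set (set Om) :=
  \bigcup_(s in `I_n) preimage_set_system setT (g s) measurable.

Hypothesis mg : forall n, measurable_fun setT (g n).
Hypothesis past_measurable : forall n, <<s past n >> `<=` measurable.
Hypothesis past_indep : forall n A B, <<s past n >> A -> measurable B ->
  P (A `&` g n @^-1` B) = (P A * normal_prob 0 1 B)%E.

(** The posterior standard deviation: every arm played has squared feature 1, so the Gram matrix
    after [t] rounds is [1 + t]. *)
Definition ts_scale (t : nat) : R := v / Num.sqrt (1 + t%:R).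

Lemma ts_scale_gt0 t : 0 < ts_scale t.
Proof. by rewrite divr_gt0// sqrtr_gt0 ltr_pwDl. Qed.

Definition ts_draw (t : nat) (w : Om) : 'cV[R]_1 := (ts_scale t * g t w)%:M.

Definition ts_choice (r : T) : 'I_3 := if 0 <= r then arm_pos else arm_neg.

Definition ts_arm (t : nat) (w : Om) : 'I_3 := ts_choice (g t w).

Lemma ts_choice_neq0 r : ts_choice r != ord0.
Proof. by rewrite /ts_choice; case: ifP. Qed.

Lemma measurable_ts_choice (A : set 'I_3) : measurable (ts_choice @^-1` A).
Proof.
rewrite (_ : _ @^-1` _ = (`[0%R, +oo[%classic `&` (fun=> arm_pos) @^-1` A) `|`
                         (`]-oo, 0%R[%classic `&` (fun=> arm_neg) @^-1` A)).
  by apply: measurableU; apply: measurableI => //; rewrite preimage_cst; case: ifP.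
apply/seteqP; split=> r /=; rewrite !in_itv/= andbT /ts_choice.
  by case: leP => _ Ar; [left|right].
by case: leP => _ [[]|[]].
Qed.

Let past_preimage s t (B : set T) : (s < t)%N -> measurable B ->
  <<s past t >> (g s @^-1` B).
Proof.
move=> st mB; apply: sub_sigma_algebra; exists s => //=.
by exists B => //; rewrite setTI.
Qed.

Let reward0 : reward (no_noise P) arm_features arm_param ts_arm = fun _ _ => 0.
Proof.
by apply/funext => s; apply/funext => w; rewrite reward_arm_neq0// ts_choice_neq0.
Qed.

(** Past arms and draws are functions of the past normal variables and rewards are constant, so
    independence from the latter past passes to the history. *)
Lemma ts_history_past t :
  <<s arm_events ts_arm t
      `|` reward_events (reward (no_noise P) arm_features arm_param ts_arm) t
      `|` draw_events ts_draw t >> `<=` <<s past t >>.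
Proof.
apply: smallest_sub; first exact: smallest_sigma_algebra.
move=> E [[|]|] [s /= st].
- move=> [A _ <-]; rewrite setTI.
  exact: (past_preimage st (measurable_ts_choice A)).
- move=> [B _ <-]; rewrite setTI reward0.
  exact: g_sigma_algebra_preimage_cst.
- move=> [i _ [B mB <-]]; rewrite setTI.
  pose f (r : T) : T := ts_scale s * r.
  have mfB : measurable (f @^-1` B).
    have mf : measurable_fun setT f by exact: measurable_funM.
    by rewrite -[X in measurable X]setTI; exact: mf.
  rewrite (_ : _ @^-1` B = g s @^-1` (f @^-1` B)); first exact: past_preimage.
  by apply/seteqP; split=> w /=; rewrite !mxE (ord1 i) eqxx.
Qed.

Let gram_ts t w :
  gram 1 (observed arm_features) (fun s => ts_arm s w) t = (1 + t%:R : R)%:M.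
Proof.
rewrite gram_arm; congr ((_ + _)%:M).
rewrite (eq_bigr (fun=> 1)) ?sumr_const ?card_ord// => s _.
by rewrite /ts_arm /ts_choice /arm_obs; case: ifP; rewrite /= ?sqrrN expr1n.
Qed.

Lemma ts_draw_gaussian t :
  cond_gaussian P
    <<s arm_events ts_arm t
        `|` reward_events (reward (no_noise P) arm_features arm_param ts_arm) t
        `|` draw_events ts_draw t >>
    (fun w => ridge 1 (observed arm_features) (fun s => ts_arm s w)
       (fun s => reward (no_noise P) arm_features arm_param ts_arm s w) t)
    (fun w => v ^+ 2 *:
       invmx (gram 1 (observed arm_features) (fun s => ts_arm s w) t))
    (ts_draw t).
Proof.
move=> u u0 B mB; pose k := u ord0 ord0 * ts_scale t.
have t1 : 0 < 1 + t%:R :> R by rewrite ltr_pwDl.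
have k0 : k != 0.
  apply: mulf_neq0; last by rewrite gt_eqF// ts_scale_gt0.
  by apply: contra u0 => /eqP u00; rewrite [u]mx11_scalar u00 raddf0.
(* The prescribed variance along [u] is that of [k * g t]; since [k] may be negative, the standard
   deviation is its absolute value. *)
have kE : v ^+ 2 * (1 + t%:R)^-1 * u ord0 ord0 ^+ 2 = k ^+ 2.
  have q2 : Num.sqrt (1 + t%:R) ^+ 2 = 1 + t%:R :> R by rewrite sqr_sqrtr// ltW.
  have q0 : Num.sqrt (1 + t%:R) != 0 :> R by rewrite gt_eqF// sqrtr_gt0.
  by rewrite /k /ts_scale -{1}q2; field.
pose f (r : T) : T := k * r.
have mfB : measurable (f @^-1` B).
  have mf : measurable_fun setT f by exact: measurable_funM.
  by rewrite -[X in measurable X]setTI; exact: mf.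
rewrite (_ : (fun w => dot u _) @^-1` B = g t @^-1` (f @^-1` B)); last first.
  by apply/seteqP; split=> w /=; rewrite dot11 !mxE eqxx mulr1n mulrA.
rewrite (_ : (fun w => fine _) = fun=> fine (normal_prob 0 `|k| B)); last first.
  apply/funext => w; rewrite ridge_reward0; last by move=> s; rewrite reward0.
  rewrite gram_ts invmx_scalar scale_scalar_mx [u]mx11_scalar qform_scalar.
  by rewrite dot11 [X in _ * X]mxE mulr0 kE sqrtr_sqr.
apply: is_cond_exp_indep.
- by rewrite -[X in measurable X]setTI; exact: mg.
- by move=> A /ts_history_past; exact: past_measurable.
- move=> A /ts_history_past pA.
  by rewrite past_indep// normal_prob_scale// fineK// fin_num_measure.
Qed.

Lemma lints_run_ts :
  lints_run (no_noise P) sigma arm_features arm_param v ts_arm ts_draw.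
Proof.
move=> t; split.
- move=> k; rewrite -[X in measurable X]setTI.
  exact: (mg _ measurableT (measurable_ts_choice [set k])).
- move=> i; rewrite (_ : (fun _ => _) = fun w => ts_scale t * g t w).
    by apply: measurable_funM => //; exact: mg.
  by apply/funext => w; rewrite !mxE (ord1 i) eqxx mulr1n.
- exact: ts_draw_gaussian.
- move=> w k; rewrite !observed_arm !dot11 !mxE !eqxx !mulr1n.
  rewrite !(mulrCA _ (ts_scale t)) ler_pM2l ?ts_scale_gt0// /ts_arm /ts_choice.
  move: (g t w : R) => r; rewrite /arm_obs.
  by have [r0|r0] := leP 0 r; case: k => -[|[|[|//]]] ? /=; lra.
- exact: cond_subgaussian0.
Qed.

End NoiselessThompson.

Theorem theorem1 (R : realType) (sigma : R) (sigma_gt0 : 0 < sigma) :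
  exists (K d du : nat) (z : 'I_K -> 'cV[R]_(d + du)) (theta : 'cV[R]_(d + du))
    (astar : 'I_K) (disp : measure_display) (Om : measurableType disp)
    (P : probability Om R) (eps : nat -> {RV P >-> R}),
  [/\ (1 <= d)%N,
      (1 <= du)%N,
      forall k : 'I_K, `|dot (z k) theta| <= 1,
      is_argmax (fun k => dot (z k) theta) astar &
      forall lambda delta S v : R,
        0 < lambda -> 0 < delta < 1 -> l2norm (usubmx theta) <= S -> 0 < v ->
      [/\ exists a : nat -> Om -> 'I_K,
            oful_run eps sigma z theta lambda delta S a,
          exists (a : nat -> Om -> 'I_K) (th : nat -> Om -> 'cV[R]_d),
            lints_run eps sigma z theta v a th &
          exists (c : R) (T0 : nat), 0 < c /\
          (forall a : nat -> Om -> 'I_K,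
             oful_run eps sigma z theta lambda delta S a ->
             forall T : nat, (T0 <= T)%N ->
               ((c * T%:R)%:E <= 'E_P[regret z theta astar a T])%E)
          /\
          (forall (a : nat -> Om -> 'I_K) (th : nat -> Om -> 'cV[R]_d),
             lints_run eps sigma z theta v a th ->
             forall T : nat, (T0 <= T)%N ->
               ((c * T%:R)%:E <= 'E_P[regret z theta astar a T])%E)]].
Proof.
exists 3, 1%N, 1%N, arm_features, arm_param, ord0, _,
  (measurableTypeR R), unif01.
exists (no_noise unif01); split=> //.
- by move=> k; rewrite dot_arm_param; case: eqP; rewrite ?normr1// normr0.
- by move=> k; rewrite !dot_arm_param eqxx; case: eqP; rewrite // ler01.
move=> lambda delta S v l0 d01 normS v0.
have S0 : 0 <= S by apply: le_trans normS; exact: sqrtr_ge0.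
split.
- by exists (fun _ _ => arm_pos); exact: oful_run_arm_pos.
- have [g [mg pm pind]] := iid_normal R.
  by exists (ts_arm g), (ts_draw g v); exact: lints_run_ts.
(* Each round costs exactly 1 almost surely, whatever the inputs of the algorithms. *)
exists 1, 0%N; split=> //; split=> [a run T _|a th run T _].
- apply: expectation_regret_ge => t.
    by move=> k; have [+ _ _] := run t; exact.
  by apply: aeW => w; exact: oful_run_neq0 run t w.
- apply: expectation_regret_ge => t.
    by move=> k; have [+ _ _ _ _] := run t; exact.
  exact: lints_run_neq0 run t.
Qed.
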